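(* Let $\mathbb{K}=\mathbb{R}$ or $\mathbb{C}$ and let $A\in\mathbb{K}^{m\times n}$, $B\in\mathbb{K}^{n\times k}$. Then $B^{+}A^{+}$ is a $\{1,2\}$-inverse of $AB$ if and only if $$\mathcal{C}(A^{+}AB)\subset\mathcal{C}(B)\quad\text{and}\quad\mathcal{C}(BB^{+}A^{+})\subset\mathcal{C}(A^{+}).$$
   Context: $M^{+}$ is the Moore--Penrose pseudoinverse and $\mathcal{C}(M)$ the column space of $M$. A matrix $X$ is a $\{1,2\}$-inverse of $M$ if $MXM=M$ and $XMX=X$. *)

(* Defs.v *)
From mathcomp Require Import all_boot all_order all_algebra.
From mathcomp Require Import classical_sets reals complex.

Set Implicit Arguments.
Unset Strict Implicit.
Unset Printing Implicit Defensive.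

Import Order.TTheory GRing.Theory Num.Theory.
Local Open Scope ring_scope.
Local Open Scope sesquilinear_scope.

(* The adjoint of M is M ^t conj, the entrywise image under conj of the       *)
(* transpose. Taking conj := idfun gives the real transpose, and              *)
(* conj := Num.conj the complex conjugate transpose.                          *)

(* The four Penrose equations. *)
Definition is_moore_penrose (K : fieldType) (conj : K -> K) (m n : nat)
    (M : 'M[K]_(m, n)) (X : 'M[K]_(n, m)) : Prop :=
  [/\ M *m X *m M = M,
      X *m M *m X = X,
      (M *m X) ^t conj = M *m X
    & (X *m M) ^t conj = X *m M].

(* Total by the default value 0, which is never used for the two conjugations *)
(* above: see real_mpinvP, complex_mpinvP and is_moore_penrose_uniq.          *)
Definition mpinv (K : fieldType) (conj : K -> K) (m n : nat)
    (M : 'M[K]_(m, n)) : 'M[K]_(n, m) :=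
  xget 0 [set X | is_moore_penrose conj M X]%classic.

Definition real_mpinv (R : realType) (m n : nat) (M : 'M[R]_(m, n)) :
    'M[R]_(n, m) := mpinv idfun M.

Definition complex_mpinv (R : realType) (m n : nat) (M : 'M[R[i]]_(m, n)) :
    'M[R[i]]_(n, m) := mpinv Num.conj M.

Definition is_12_inverse (K : fieldType) (m n : nat)
    (M : 'M[K]_(m, n)) (X : 'M[K]_(n, m)) : Prop :=
  M *m X *m M = M /\ X *m M *m X = X.

Definition colspace (K : fieldType) (m n : nat) (M : 'M[K]_(m, n)) :
    {vspace 'cV[K]_m} := <<[seq col j M | j : 'I_n]>>%VS.

Section MoorePenrose.
Variables (K : fieldType) (conj : {rmorphism K -> K}).
Hypothesis conjK : involutive conj.

Let adjM m n p (A : 'M[K]_(m, n)) (B : 'M[K]_(n, p)) :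
  (A *m B) ^t conj = B ^t conj *m A ^t conj.
Proof. by rewrite trmx_mul map_mxM. Qed.

Let adjK m n (A : 'M[K]_(m, n)) : A ^t conj ^t conj = A.
Proof. by apply/matrixP => i j; rewrite !mxE conjK. Qed.

Lemma is_moore_penrose_uniq m n (A : 'M[K]_(m, n)) (X Y : 'M[K]_(n, m)) :
  is_moore_penrose conj A X -> is_moore_penrose conj A Y -> X = Y.
Proof.
move=> [X1 X2 X3 X4] [Y1 Y2 Y3 Y4].
have AXY : A *m X = A *m Y.
  by rewrite -X3 -{1}Y1 -(mulmxA (A *m Y)) adjM X3 Y3 mulmxA X1.
have XYA : X *m A = Y *m A.
  by rewrite -X4 -{1}Y1 -mulmxA mulmxA adjM X4 Y4 mulmxA -(mulmxA Y) -mulmxA X1.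
by rewrite -X2 XYA -mulmxA AXY mulmxA Y2.
Qed.

Hypothesis conj_pos :
  forall n (v : 'rV[K]_n), v *m v ^t conj = 0 -> v = 0.

Let gram_unit m n (G : 'M[K]_(m, n)) :
  row_free G -> G *m G ^t conj \in unitmx.
Proof.
move=> freeG; rewrite -row_free_unit; apply: inj_row_free => v vG0.
have vG : v *m G = 0.
  by apply: conj_pos; rewrite adjM mulmxA -(mulmxA v) vG0 mul0mx.
by apply: (row_free_inj freeG); rewrite vG mul0mx.
Qed.

Let adj_gramV m n (G : 'M[K]_(m, n)) :
  (invmx (G *m G ^t conj)) ^t conj = invmx (G *m G ^t conj).
Proof. by rewrite trmx_inv map_invmx adjM adjK. Qed.

(* For a full rank factorization A = F G, with H = F^* below,                 *)
(* the pseudoinverse is G^* (G G^* )^-1 (F^* F)^-1 F^*.                       *)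
Let is_moore_penrose_full_rank m r n (H : 'M[K]_(r, m)) (G : 'M[K]_(r, n)) :
  row_free H -> row_free G ->
  is_moore_penrose conj (H ^t conj *m G)
    (G ^t conj *m invmx (G *m G ^t conj) *m invmx (H *m H ^t conj) *m H).
Proof.
move=> freeH freeG.
set F := H ^t conj; set P := invmx (G *m _); set Q := invmx (H *m _).
set A := F *m G; set X := _ *m H.
have GP : G *m G ^t conj *m P = 1%:M by rewrite mulmxV ?gram_unit.
have QF : Q *m (H *m F) = 1%:M by rewrite mulVmx ?gram_unit.
have AX : A *m X = F *m Q *m H.
  by rewrite /A /X !mulmxA -2!(mulmxA F) GP mulmx1.
have XA : X *m A = G ^t conj *m P *m G.
  by rewrite /A /X !mulmxA -(mulmxA _ H) -(mulmxA _ Q) QF mulmx1.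
split.
- by rewrite AX /A mulmxA -(mulmxA _ H) -(mulmxA _ Q) QF mulmx1.
- rewrite XA /X !mulmxA -(mulmxA _ G (G ^t conj)).
  by rewrite -(mulmxA _ (G *m G ^t conj)) GP mulmx1.
- by rewrite AX !adjM adj_gramV /F adjK mulmxA.
- by rewrite XA !adjM adj_gramV adjK mulmxA.
Qed.

Lemma is_moore_penrose_exists m n (A : 'M[K]_(m, n)) :
  exists X, is_moore_penrose conj A X.
Proof.
have freeH : row_free ((col_base A) ^t conj).
  by rewrite /row_free mxrank_map mxrank_tr; exact: col_base_full.
have := is_moore_penrose_full_rank freeH (row_base_free A).
by rewrite adjK mulmx_base => AX; eexists; exact: AX.
Qed.

Lemma mpinvP m n (A : 'M[K]_(m, n)) : is_moore_penrose conj A (mpinv conj A).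
Proof. exact: (xgetPex 0 (is_moore_penrose_exists A)). Qed.

End MoorePenrose.

Lemma real_mpinvP (R : realType) (m n : nat) (A : 'M[R]_(m, n)) :
  is_moore_penrose idfun A (real_mpinv A).
Proof.
apply: (@mpinvP R idfun) => // k v /matrixP/(_ 0 0).
rewrite !mxE => /eqP; rewrite psumr_eq0 => [/allP v0|i _]; last first.
  by rewrite !mxE -expr2 sqr_ge0.
apply/rowP => i; rewrite mxE; apply/eqP.
by have := v0 i (mem_index_enum i); rewrite !mxE /= mulf_eq0 orbb.
Qed.

Lemma complex_mpinvP (R : realType) (m n : nat) (A : 'M[R[i]]_(m, n)) :
  is_moore_penrose Num.conj A (complex_mpinv A).
Proof.
apply: (@mpinvP _ Num.conj) => [|k v /matrixP/(_ 0 0)]; first exact: conjCK.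
rewrite !mxE => /eqP; rewrite psumr_eq0 => [/allP v0|i _]; last first.
  by rewrite !mxE mul_conjC_ge0.
apply/rowP => i; rewrite mxE; apply/eqP.
by have := v0 i (mem_index_enum i); rewrite !mxE /= mul_conjC_eq0.
Qed.

(* Main.v *)
Require Import Defs.
From mathcomp Require Import all_boot all_order all_algebra.
From mathcomp Require Import reals complex.

(** Put P = A^+ A and Q = B B^+, the orthogonal projectors onto C(A^+ ) and
    C(B). The theorem holds because the first property and each of the two
    inclusions are equivalent to P Q = Q P.

    - C(A^+ A B) <= C(B) says that Q fixes the columns of P B, that is
      Q P Q = P Q. The left side is self-adjoint, hence so is P Q, whose
      adjoint is Q P ([colspace_proj_mul_sub]).
    - C(B B^+ A^+ ) <= C(A^+ ) is the previous inclusion for the pair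
      (B^+, A^+ ), in which P and Q are exchanged.
    - If B^+ A^+ is an inner inverse of A B then P Q is idempotent. For
      D = P Q - Q P Q this gives D^* D = Q P Q - Q P Q P Q = 0, hence D = 0,
      and again P Q = Q P Q is self-adjoint ([proj_mul_idem_commute]).

    The step from D^* D = 0 to D = 0 is where positivity of the inner product
    enters. It follows from the existence of a Moore-Penrose inverse of D
    ([adj_mul_eq0]), so a single proof serves the real and the complex case. *)

Set Implicit Arguments.
Unset Strict Implicit.
Unset Printing Implicit Defensive.

Import GRing.Theory.

Local Open Scope ring_scope.
Local Open Scope sesquilinear_scope.

Section ColumnSpace.
Variable K : fieldType.

Lemma mulmx_colspace (m n : nat) (N : 'M[K]_(m, n)) (w : 'cV[K]_n) :
  N *m w \in colspace N.
Proof.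
have -> : N *m w = \sum_i w i 0 *: col i N.
  apply/matrixP => i j; rewrite (ord1 j) summxE !mxE; apply: eq_bigr => l _.
  by rewrite !mxE mulrC.
apply: memv_suml => i _; apply: memvZ; apply: memv_span.
by apply/mapP; exists i; rewrite ?mem_enum.
Qed.

(** If N X N = N then N X is a projector onto C(N), so inclusion in C(N)
    becomes a matrix equation. *)
Lemma colspace_subP (m n p : nat) (N : 'M[K]_(m, n)) (X : 'M[K]_(n, m))
    (M : 'M[K]_(m, p)) :
  N *m X *m N = N ->
  (colspace M <= colspace N)%VS <-> N *m X *m M = M.
Proof.
move=> NXN; split=> [sMN | NXM]; last first.
  apply/span_subvP => _ /mapP[j _ ->].
  by rewrite -NXM colE -!mulmxA; apply: mulmx_colspace.
(* The vectors fixed by N X form a subspace, the kernel of N X - 1. *)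
pose f : 'Hom('cV[K]_m, 'cV[K]_m) := linfun (mulmx (N *m X - 1%:M)).
have kerN : (colspace N <= lker f)%VS.
  apply/span_subvP => _ /mapP[j _ ->].
  by rewrite memv_ker lfunE /= colE mulmxA mulmxBl NXN mul1mx subrr mul0mx.
have colM j : col j (N *m X *m M) = col j M.
  have : col j M \in lker f.
    apply: (subvP (subv_trans sMN kerN)); apply: memv_span.
    by apply/mapP; exists j; rewrite ?mem_enum.
  by rewrite memv_ker lfunE /= mulmxBl mul1mx subr_eq0 !colE mulmxA => /eqP.
apply/matrixP => i j.
by have /matrixP/(_ i 0) := colM j; rewrite !mxE.
Qed.

End ColumnSpace.

Section ReverseOrder.
Variables (K : fieldType) (conj : {rmorphism K -> K}).

Lemma adj_mul (m n p : nat) (M : 'M[K]_(m, n)) (N : 'M[K]_(n, p)) :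
  (M *m N) ^t conj = N ^t conj *m M ^t conj.
Proof. by rewrite trmx_mul map_mxM. Qed.

Lemma is_moore_penrose_sym (m n : nat) (M : 'M[K]_(m, n)) (X : 'M[K]_(n, m)) :
  is_moore_penrose conj M X -> is_moore_penrose conj X M.
Proof. by case. Qed.

(** M = (M X) M = (M X)^* M = X^* (M^* M). *)
Lemma adj_mul_eq0 (m n : nat) (M : 'M[K]_(m, n)) (X : 'M[K]_(n, m)) :
  is_moore_penrose conj M X -> M ^t conj *m M = 0 -> M = 0.
Proof.
by case=> MXM _ MXh _ MM0; rewrite -MXM -MXh adj_mul -mulmxA MM0 mulmx0.
Qed.

Section Projectors.
Variables (n : nat) (P Q : 'M[K]_n).
Hypotheses (Ph : P ^t conj = P) (Qh : Q ^t conj = Q).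

(** Q P Q is self-adjoint, and Q P is the adjoint of P Q. *)
Lemma proj_fix_commute : Q *m P *m Q = P *m Q -> P *m Q = Q *m P.
Proof.
move=> QPQ; rewrite -[in RHS]Ph -[in RHS]Qh -adj_mul -QPQ.
by rewrite !adj_mul Ph Qh mulmxA.
Qed.

Lemma proj_mul_idem_commute :
  Q *m Q = Q -> (exists X, is_moore_penrose conj (P *m Q - Q *m P *m Q) X) ->
  P *m P = P -> P *m Q *m (P *m Q) = P *m Q -> P *m Q = Q *m P.
Proof.
move=> QQ [X DX] PP PQPQ; apply: proj_fix_commute.
apply/esym/eqP; rewrite -subr_eq0; apply/eqP/(adj_mul_eq0 DX).
set D := P *m Q - _.
have -> : D ^t conj = Q *m P - Q *m P *m Q.
  by rewrite /D linearB /= map_mxB !adj_mul Ph Qh mulmxA.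
have QPD : Q *m P *m D = 0.
  rewrite mulmxBr !mulmxA -(mulmxA Q P P) PP -(mulmxA Q P Q).
  by rewrite -!(mulmxA Q) -(mulmxA _ P Q) PQPQ subrr.
have QD : Q *m D = 0 by rewrite mulmxBr !mulmxA QQ subrr.
by rewrite mulmxBl QPD -(mulmxA _ Q D) QD mulmx0 subrr.
Qed.

End Projectors.

(** With P = X A and Q = B Y, the inclusion reads Q P B = P B; multiplying by Y
    on the right gives Q P Q = P Q. *)
Lemma colspace_proj_mul_sub (m n k : nat) (A : 'M[K]_(m, n)) (B : 'M[K]_(n, k))
    (X : 'M[K]_(n, m)) (Y : 'M[K]_(k, n)) :
  is_moore_penrose conj A X -> is_moore_penrose conj B Y ->
  (colspace (X *m A *m B) <= colspace B)%VS <->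
  X *m A *m (B *m Y) = B *m Y *m (X *m A).
Proof.
move=> [_ _ _ Ph] [BYB _ Qh _].
apply: (iff_trans (colspace_subP _ BYB)).
split=> [QPB | PQ]; last by rewrite mulmxA -PQ -mulmxA BYB.
apply: proj_fix_commute => //.
by rewrite [in RHS]mulmxA -[in RHS]QPB !mulmxA.
Qed.

Hypothesis mp_exists :
  forall (m n : nat) (M : 'M[K]_(m, n)), exists X, is_moore_penrose conj M X.

(** With P = X A and Q = B Y, multiplying A B (Y X) A B = A B by X on the left
    and by Y on the right gives P Q P Q = P Q. Conversely P and Q occur in the
    middle of A B (Y X) A B = A Q P B and of Y X (A B) Y X = Y P Q X; once
    exchanged, they are absorbed by the outer factors. *)
Lemma is_12_inverse_commute (m n k : nat) (A : 'M[K]_(m, n))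
    (B : 'M[K]_(n, k)) (X : 'M[K]_(n, m)) (Y : 'M[K]_(k, n)) :
  is_moore_penrose conj A X -> is_moore_penrose conj B Y ->
  is_12_inverse (A *m B) (Y *m X) <->
  X *m A *m (B *m Y) = B *m Y *m (X *m A).
Proof.
move=> [AXA XAX _ Ph] [BYB YBY Qh _]; split=> [[inner _] | PQ].
  apply: proj_mul_idem_commute => //; first by rewrite mulmxA BYB.
    by rewrite mulmxA XAX.
  by have := congr1 (fun M => X *m M *m Y) inner; rewrite /= !mulmxA.
split.
  have -> : A *m B *m (Y *m X) *m (A *m B) = A *m (B *m Y *m (X *m A)) *m B.
    by rewrite !mulmxA.
  by rewrite -PQ !mulmxA AXA -!mulmxA [B *m (_ *m _)]mulmxA BYB.
have -> : Y *m X *m (A *m B) *m (Y *m X) = Y *m (X *m A *m (B *m Y)) *m X.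
  by rewrite !mulmxA.
by rewrite PQ !mulmxA YBY -!mulmxA [X *m (_ *m _)]mulmxA XAX.
Qed.

Lemma reverse_order_12_inverse (m n k : nat) (A : 'M[K]_(m, n))
    (B : 'M[K]_(n, k)) (X : 'M[K]_(n, m)) (Y : 'M[K]_(k, n)) :
  is_moore_penrose conj A X -> is_moore_penrose conj B Y ->
  is_12_inverse (A *m B) (Y *m X) <->
  (colspace (X *m A *m B) <= colspace B)%VS /\
  (colspace (B *m Y *m X) <= colspace X)%VS.
Proof.
move=> AX BY.
have subB := colspace_proj_mul_sub AX BY.
have subX := colspace_proj_mul_sub
  (is_moore_penrose_sym BY) (is_moore_penrose_sym AX).
apply: (iff_trans (is_12_inverse_commute AX BY)).
split=> [PQ | [/subB //]].
by split; [apply/subB | apply/subX; rewrite PQ].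
Qed.

End ReverseOrder.

Theorem theorem9p4 (R : realType) :
  (forall (m n k : nat) (A : 'M[R]_(m, n)) (B : 'M[R]_(n, k)),
     is_12_inverse (A *m B) (real_mpinv B *m real_mpinv A) <->
     (colspace (real_mpinv A *m A *m B) <= colspace B)%VS /\
     (colspace (B *m real_mpinv B *m real_mpinv A)
        <= colspace (real_mpinv A))%VS)
  /\
  (forall (m n k : nat) (A : 'M[R[i]]_(m, n)) (B : 'M[R[i]]_(n, k)),
     is_12_inverse (A *m B) (complex_mpinv B *m complex_mpinv A) <->
     (colspace (complex_mpinv A *m A *m B) <= colspace B)%VS /\
     (colspace (B *m complex_mpinv B *m complex_mpinv A)
        <= colspace (complex_mpinv A))%VS).
Proof.
split=> m n k A B.
  apply: (@reverse_order_12_inverse R idfun); try exact: real_mpinvP.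
  by move=> p q M; exists (real_mpinv M); exact: real_mpinvP.
apply: (@reverse_order_12_inverse _ Num.conj); try exact: complex_mpinvP.
by move=> p q M; exists (complex_mpinv M); exact: complex_mpinvP.
Qed.
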